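(* For $n\ge 0$ and $0\le k\le\lfloor n/2\rfloor$ define $$d_{n-k,k}=\begin{cases}\sum_{i=2}^{n-1}r_i & k=1,\\[2pt] \sum_{i=k}^{n-k}r_i & k=0\text{ or }k>1.\end{cases}$$ Then $$\sum_{\pi\in\mathcal{NC}(n)}\mathbf{q}^{\mathrm{Desing}(\pi)}=\sum_{k=0}^{\lfloor n/2\rfloor}d_{n-k,k}\left(\sum_{T\in\mathrm{SYT}(n-k,k)}\mathbf{q}^{\mathrm{Des}(T)}\right),$$ and consequently $$\sum_{\pi\in\mathcal{NC}(n)}\mathcal{F}_{n,\mathrm{Desing}(\pi)}=\sum_{k=0}^{\lfloor n/2\rfloor}d_{n-k,k}\,s_{(n-k,k)} .$$
   Context: $[n]=\{1,\dots,n\}$. $\mathcal{NC}(n)$ is the set of non-crossing set partitions of $[n]$ (no two arcs $(i_1,j_1),(i_2,j_2)$ with $i_1<i_2<j_1<j_2$, where the arcs are the pairs of consecutive elements of a common block). For a set partition $\pi$ of $[n]$, $\mathrm{Sing}(\pi)$ is the set of elements $i$ such that $\{i\}$ is a block of $\pi$, and $\mathrm{Desing}(\pi)=\{i\in[n-1] : i\in\mathrm{Sing}(\pi),\ i+1\notin\mathrm{Sing}(\pi)\}$. $r_m$ (Riordan number) is the number of non-crossing set partitions of $[m]$ with no singleton blocks; the sequence for $m=0,1,2,\dots$ begins $1,0,1,1,3,6,15,36,91,\dots$. $\mathrm{SYT}(n-k,k)$ is the set of standard Young tableaux of shape $(n-k,k)$ (one-row shape $(n)$ if $k=0$), drawn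 in English notation, and $\mathrm{Des}(T)=\{i : i+1 \text{ is in a lower row of } T \text{ than } i\}$. For $A\subseteq[n-1]$, $\mathbf{q}^A=\prod_{i\in A}q_i$, where $q_1,\dots,q_{n-1}$ are commuting variables. For $D\subseteq[n-1]$, $\mathcal{F}_{n,D}=\sum x_{i_1}\cdots x_{i_n}$, summed over $i_1\le\dots\le i_n$ with $i_j<i_{j+1}$ whenever $j\in D$ (fundamental quasi-symmetric function). $s_\lambda$ is the Schur function. *)

(* Defs.v *)
From mathcomp Require Import boolp classical_sets functions cardinality fsbigop.
From mathcomp Require Import monalg.
From mathcomp Require Import all_boot all_order all_algebra.
Set Implicit Arguments.
Unset Strict Implicit.
Unset Printing Implicit Defensive.

Import GRing.Theory.
Local Open Scope ring_scope.

(** The set [n] = {1, ..., n} is ['I_n] and [n-1] is ['I_n.-1], both shifted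
    down by one.  For i : 'I_n.-1, [lo i] and [hi i] are the elements of [n]
    usually written i and i + 1, once the shift is undone. *)

Lemma hi_subproof (n : nat) (i : 'I_n.-1) : (i.+1 < n)%N.
Proof. by rewrite -ltn_predRL. Qed.

Definition lo (n : nat) (i : 'I_n.-1) : 'I_n := widen_ord (leq_pred n) i.
Definition hi (n : nat) (i : 'I_n.-1) : 'I_n := Ordinal (hi_subproof i).

Definition is_arc (n : nat) (P : {set {set 'I_n}}) (i j : 'I_n) : bool :=
  (i < j)%N &&
  [exists B in P, [&& i \in B, j \in B & [forall k in B, ~~ (i < k < j)%N]]].

Definition noncrossing (n : nat) (P : {set {set 'I_n}}) : bool :=
  [forall i1 : 'I_n, forall j1 : 'I_n, forall i2 : 'I_n, forall j2 : 'I_n,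
     is_arc P i1 j1 && is_arc P i2 j2 ==> ~~ [&& i1 < i2, i2 < j1 & j1 < j2]%N].

Definition NC (n : nat) : {set {set {set 'I_n}}} :=
  [set P | partition P [set: 'I_n] && noncrossing P].

Definition Sing (n : nat) (P : {set {set 'I_n}}) : {set 'I_n} :=
  [set i | [set i] \in P].

Definition Desing (n : nat) (P : {set {set 'I_n}}) : {set 'I_n.-1} :=
  [set i | (lo i \in Sing P) && (hi i \notin Sing P)].

Definition riordan (m : nat) : nat := #|[set P in NC m | Sing P == set0]|.

(** [dcoef n k] is d_{n-k,k}. *)
Definition dcoef (n k : nat) : nat :=
  if k == 1%N then (\sum_(2 <= i < n) riordan i)%N
  else (\sum_(k <= i < (n - k).+1) riordan i)%N.

(** A shape is the sequence of its row lengths, from top to bottom; a trailing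
    row of length 0 contributes no cell, so [two_row n 0] is the shape (n). *)
Definition two_row (n k : nat) : seq nat := [:: (n - k)%N; k].

Definition cell (sh : seq nat) : finType :=
  {i : 'I_(size sh) & 'I_(nth 0%N sh i)}.

Definition crow (sh : seq nat) (c : cell sh) : nat := tag c.
Definition ccol (sh : seq nat) (c : cell sh) : nat := tagged c.

Definition SYT (sh : seq nat) (n : nat) : {set {ffun cell sh -> 'I_n}} :=
  [set T : {ffun cell sh -> 'I_n} |
    [&& [forall i, #|[set c | T c == i]| == 1%N],
        [forall c, forall c',
           (crow c == crow c') && (ccol c < ccol c')%N ==> (T c < T c')%N]
      & [forall c, forall c',
           (ccol c == ccol c') && (crow c < crow c')%N ==> (T c < T c')%N]]].

Definition Des (sh : seq nat) (n : nat) (T : {ffun cell sh -> 'I_n}) :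
    {set 'I_n.-1} :=
  [set i | [exists c, exists c',
     [&& T c == lo i, T c' == hi i & (crow c < crow c')%N]]].

(** Here [<< ucm i >>] is the polynomial variable of index i. *)
Definition qmon (n : nat) (A : {set 'I_n.-1}) : {mpoly int[n.-1]} :=
  \prod_(i in A) << ucm i >>.

(** A series in x_0, x_1, x_2, ... is the function giving the coefficient of
    each monomial; addition and integer multiples are pointwise. *)
Notation monom := (cmonom nat).
Notation series := (monom -> int).

Definition wmon (I : finType) (w : {ffun I -> nat}) : monom :=
  \big[mmul/mone]_(t : I) ucm (w t).

(** The sum of the monomials [wmon w] over the possibly infinite set A.  Only
    finitely many w have a given monomial, so the inner sum is always finite. *)
Definition gen_series (I : finType) (A : set {ffun I -> nat}) : series :=
  fun m => \sum_(w \in A) ((wmon w == m)%:R : int).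

Definition fundamental (n : nat) (D : {set 'I_n.-1}) : series :=
  gen_series [set w : {ffun 'I_n -> nat} |
    (forall i j : 'I_n, (i <= j)%N -> (w i <= w j)%N) /\
    (forall i : 'I_n.-1, i \in D -> (w (lo i) < w (hi i))%N)]%classic.

Definition schur (sh : seq nat) : series :=
  gen_series [set T : {ffun cell sh -> nat} |
    (forall c c' : cell sh,
       crow c = crow c' -> (ccol c < ccol c')%N -> (T c <= T c')%N) /\
    (forall c c' : cell sh,
       ccol c = ccol c' -> (crow c < crow c')%N -> (T c < T c')%N)]%classic.

(* Main.v *)
(** Singletons lie on no arc, so a non-crossing partition with
    singleton set S amounts to a singleton-free non-crossing partition of the
    complement of S.  The left-hand side is therefore the sum over binary words
    (1 for a non-singleton) of r_j q^Asc(w), with j the number of 1s.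

    Let W(n,j) be the sum of q^Asc(w) over words of length n with j ones, and
    B(n,k) the same sum over ballot words with k ones; recording the labels of
    the second row identifies B(n,k) with the sum over SYT(n-k,k).  Removing the
    last letters shows that W satisfies
      W(n+2,j+1) = W(n+1,j+1) + W(n+1,j) + (q_n - 1) W(n,j)
    (with q indexed from 0), and so does B as long as 2(j+1) <= n+2; whence
    W(n,j) = W(n,n-j) and W(n,k) - W(n,k-1) = B(n,k) for 2k <= n.  So B(n,k) occurs in W(n,j) exactly for k <= j <= n-k, which gives d_{n-k,k}.

    For the quasi-symmetric version, the coefficient of a monomial in F_{n,D} is
    a sum over increasing words w of prod_{i in D} q_i, with q_i = 1 if
    w_i < w_{i+1} and q_i = 0 otherwise, so the first identity can be applied
    for each w; Schur functions are handled by standardization. *)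

Require Import Defs.
From mathcomp Require Import boolp classical_sets functions cardinality fsbigop.
From mathcomp Require Import finmap monalg.
From mathcomp Require Import all_boot all_order all_algebra.
From mathcomp Require Import zify ring.
Import GRing.Theory.
Local Open Scope ring_scope.

Set Implicit Arguments.
Unset Strict Implicit.
Unset Printing Implicit Defensive.

(** * Binary words counted by ascents *)

Section BinaryWords.
Variables (R : comPzRingType) (q : nat -> R).

Definition ascent_weight (n : nat) (w : seq bool) : R :=
  \prod_(i < n.-1) (if ~~ nth false w i && nth false w i.+1 then q i else 1).

Definition ballot (w : seq bool) : bool :=
  [forall p : 'I_(size w).+1, (count id (take p w)).*2 <= p]%N.

Definition word_sum (n j : nat) : R :=
  \sum_(t : n.-tuple bool | count id t == j) ascent_weight n t.

Definition ballot_sum (n k : nat) : R :=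
  \sum_(t : n.-tuple bool | (count id t == k) && ballot t) ascent_weight n t.

Lemma count_rcons (w : seq bool) b : count id (rcons w b) = (count id w + b)%N.
Proof. by rewrite -cats1 count_cat /= addn0. Qed.

Lemma sum_tuple_rcons (V : nmodType) n (P : pred (seq bool)) (F : seq bool -> V) :
  \sum_(t : n.+1.-tuple bool | P t) F t =
  \sum_(t : n.-tuple bool | P (rcons t false)) F (rcons t false) +
  \sum_(t : n.-tuple bool | P (rcons t true)) F (rcons t true).
Proof.
pose h (u : n.-tuple bool * bool) := [tuple of rcons u.1 u.2].
have bij_h : bijective h.
  exists (fun t : n.+1.-tuple bool =>
    ([tuple of belast (thead t) (behead t)], last (thead t) (behead t))).
    case=> [[u us] b]; congr pair; last first.
      by rewrite /h /=; case: (u) us => [|x s] us //=; rewrite last_rcons.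
    apply: val_inj; rewrite /= {1}/thead (tnth_nth false) /=.
    by case: (u) us => [|x s] us //=; rewrite belast_rcons.
  by move=> t; apply: val_inj => /=; rewrite -lastI {3}(tuple_eta t).
rewrite (reindex h) /=; last exact: onW_bij.
pose G (t : n.-tuple bool) b := if P (rcons t b) then F (rcons t b) else 0.
rewrite [LHS]big_mkcond /= -(pair_bigA _ G) /=.
rewrite (eq_bigr (fun t => G t false + G t true)).
  by rewrite big_split /= -!big_mkcond.
by move=> t _; rewrite big_bool addrC.
Qed.

Lemma ascent_weight_rcons2 n (w : n.-tuple bool) a b :
  ascent_weight n.+2 (rcons (rcons w a) b) =
  ascent_weight n.+1 (rcons w a) * (if ~~ a && b then q n else 1).
Proof.
rewrite /ascent_weight /= big_ord_recr /=; congr (_ * _).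
  apply: eq_bigr => i _.
  by rewrite !nth_rcons !size_rcons !size_tuple !ltnS (ltnW (ltn_ord i)) !ltn_ord.
by rewrite !nth_rcons !size_rcons !size_tuple ltnSn !ltnn !eqxx.
Qed.

(** A final 0 completes no ascent. The case n = 0 is apart because [n.-1] truncates and both
    products are empty. *)
Lemma ascent_weight_rcons_false n (w : n.-tuple bool) :
  ascent_weight n.+1 (rcons w false) = ascent_weight n w.
Proof.
case: n w => [|n] w; first by rewrite /ascent_weight !big_ord0.
rewrite /ascent_weight /= big_ord_recr /= [X in _ * X]ifF ?mulr1; last first.
  by rewrite !nth_rcons !size_tuple ltnn eqxx andbF.
by apply: eq_bigr => i _; rewrite !nth_rcons !size_tuple !ltnS ltn_ord ltnW.
Qed.

Lemma ballot_rcons w b :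
  ballot (rcons w b) = ballot w && ((count id w + b).*2 <= (size w).+1)%N.
Proof.
apply/forallP/andP.
  move=> H; split; last first.
    by have := H ord_max; rewrite /= take_size size_rcons count_rcons.
  apply/forallP => p.
  have lt_p : (p < (size (rcons w b)).+1)%N by rewrite size_rcons ltnS ltnW.
  by have := H (Ordinal lt_p); rewrite /= -cats1 takel_cat // -ltnS.
case=> /forallP H1 H2 [p /=].
rewrite size_rcons ltnS leq_eqVlt => /orP[/eqP-> | lt_p].
  by rewrite take_oversize ?size_rcons // count_rcons.
by have := H1 (Ordinal lt_p); rewrite -cats1 takel_cat.
Qed.

Lemma ballot_count w : ballot w -> ((count id w).*2 <= size w)%N.
Proof. by move=> /forallP/(_ ord_max); rewrite /= take_size. Qed.

Lemma word_sum_large n j : (n < j)%N -> word_sum n j = 0.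
Proof.
move=> lt_nj; rewrite /word_sum big1 // => t /eqP ct.
by have := count_size id t; rewrite size_tuple ct leqNgt lt_nj.
Qed.

Lemma ballot_sum_large n k : (n < k.*2)%N -> ballot_sum n k = 0.
Proof.
move=> lt_nk; rewrite /ballot_sum big1 // => t /andP[/eqP ct /ballot_count].
by rewrite size_tuple ct leqNgt lt_nk.
Qed.

Lemma word_sum_n0 n : word_sum n 0 = 1.
Proof.
elim: n => [|n IHn].
  rewrite /word_sum (big_pred1 [tuple]) /ascent_weight ?big_ord0 // => t.
  by rewrite tuple0.
rewrite -IHn /word_sum.
rewrite (sum_tuple_rcons _ (fun w => count id w == 0%N) (ascent_weight n.+1)).
rewrite [X in _ + X]big_pred0; last first.
  by move=> t; rewrite count_rcons addn1.
rewrite addr0; apply: eq_big => t; first by rewrite count_rcons addn0.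
by rewrite ascent_weight_rcons_false.
Qed.

Lemma ballot_sum_n0 n : ballot_sum n 0 = 1.
Proof.
rewrite -(word_sum_n0 n); apply: eq_bigl => t; case: eqP => //= ct.
apply/forallP => p.
have : (count id (take p t) <= count id t)%N.
  by rewrite -[X in (_ <= count id X)%N](cat_take_drop p) count_cat leq_addr.
by rewrite ct leqn0 => /eqP->.
Qed.

(** Words ending in 0 give the first sum. Deleting a final 1 leaves a P'-word of length n+1, and
    restoring it creates an ascent of weight [q n] only when that word ends in 0; such words are the
    P'-words of length n followed by 0, whence the correction [q n - 1]. Abstract predicates let
    words and ballot words share the argument. *)
Lemma ascent_sum_recurrence n (P P' : pred (seq bool)) :
    (forall w, P (rcons w false) = P w) ->
    (forall w, P' (rcons w false) = P' w) ->
    (forall w, size w = n.+1 -> P (rcons w true) = P' w) ->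
  \sum_(t : n.+2.-tuple bool | P t) ascent_weight n.+2 t =
  \sum_(t : n.+1.-tuple bool | P t) ascent_weight n.+1 t +
  \sum_(t : n.+1.-tuple bool | P' t) ascent_weight n.+1 t +
  (q n - 1) * \sum_(t : n.-tuple bool | P' t) ascent_weight n t.
Proof.
move=> Pf P'f Pt.
have split_last m (Q : pred (seq bool)) : (forall w, Q (rcons w false) = Q w) ->
    \sum_(t : m.+1.-tuple bool | Q t) ascent_weight m.+1 t =
    \sum_(t : m.-tuple bool | Q t) ascent_weight m t +
    \sum_(t : m.-tuple bool | Q (rcons t true)) ascent_weight m.+1 (rcons t true).
  move=> Qf; rewrite (sum_tuple_rcons _ Q (ascent_weight m.+1)); congr (_ + _).
  by apply: eq_big => t; rewrite ?Qf // ascent_weight_rcons_false.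
rewrite (split_last _ _ Pf).
have -> : \sum_(t : n.+1.-tuple bool | P (rcons t true)) ascent_weight n.+2 (rcons t true) =
    \sum_(t : n.-tuple bool | P' t) ascent_weight n t * q n +
    \sum_(t : n.-tuple bool | P' (rcons t true)) ascent_weight n.+1 (rcons t true).
  rewrite (eq_bigl (fun t : n.+1.-tuple bool => P' t)); last first.
    by move=> t; rewrite Pt ?size_tuple.
  rewrite (sum_tuple_rcons _ P' (fun w => ascent_weight n.+2 (rcons w true))).
  congr (_ + _); apply: eq_big => t; rewrite ?P'f // ascent_weight_rcons2 /= ?mulr1 //.
  by rewrite ascent_weight_rcons_false.
by rewrite -mulr_suml (split_last _ _ P'f); ring.
Qed.

Lemma word_sum_recurrence n j :
  word_sum n.+2 j.+1 =
  word_sum n.+1 j.+1 + word_sum n.+1 j + (q n - 1) * word_sum n j.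
Proof.
apply: (@ascent_sum_recurrence n (fun w => count id w == j.+1) (fun w => count id w == j)).
- by move=> w; rewrite count_rcons addn0.
- by move=> w; rewrite count_rcons addn0.
- by move=> w _; rewrite count_rcons addn1.
Qed.

Lemma ballot_sum_recurrence n k : (k.+1.*2 <= n.+2)%N ->
  ballot_sum n.+2 k.+1 =
  ballot_sum n.+1 k.+1 + ballot_sum n.+1 k + (q n - 1) * ballot_sum n k.
Proof.
move=> le_kn.
have rcons_false w : ballot (rcons w false) = ballot w.
  by rewrite ballot_rcons; case: (boolP (ballot w)) => // /ballot_count; lia.
apply: (@ascent_sum_recurrence n (fun w => (count id w == k.+1) && ballot w)
  (fun w => (count id w == k) && ballot w)).
- by move=> w; rewrite count_rcons addn0 rcons_false.
- by move=> w; rewrite count_rcons addn0 rcons_false.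
(* The prefix condition created by the appended 1 is exactly [le_kn]. *)
- move=> w sz_w; rewrite count_rcons ballot_rcons addn1 eqSS sz_w.
  by case: eqP => //= ->; rewrite le_kn andbT.
Qed.

Lemma word_sum_nn n : word_sum n n = 1.
Proof.
elim/ltn_ind: n => -[|[|n]] IH; first exact: word_sum_n0.
  rewrite /word_sum (big_pred1 [tuple true]) /ascent_weight ?big_ord0 // => t.
  by case/tupleP: t => -[] t; rewrite (tuple0 t).
by rewrite word_sum_recurrence !(word_sum_large (ltnSn _)) IH // mulr0 addr0 add0r.
Qed.

(** Replacing the number of ones by the number of zeros swaps the first two terms of the recurrence
    and preserves the third; on the boundary both sides are 1. *)
Lemma word_sum_sym i j : word_sum (i + j) i = word_sum (i + j) j.
Proof.
move: {2}(i + j)%N (erefl (i + j)%N) => m; elim/ltn_ind: m i j => m IH [|i] [|j] e_m //.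
- by rewrite add0n word_sum_n0 word_sum_nn.
- by rewrite addn0 word_sum_n0 word_sum_nn.
rewrite addSn addnS !word_sum_recurrence -addnS (IH (i + j.+1)%N) //; last lia.
rewrite addnS (IH (i + j)%N) //; last lia.
by rewrite -addSn (IH (i.+1 + j)%N) 1?[X in X + _]addrC //; lia.
Qed.

(* The weighted reflection principle: both sides obey the same three-term
   recurrence up to [2 * k.+1 <= n], and on the boundary [2 * k.+1 = n.+1] the
   ballot sum vanishes, which matches the symmetry of [word_sum]. *)
Lemma word_sumS n k : (k.+1.*2 <= n.+1)%N ->
  word_sum n k.+1 = word_sum n k + ballot_sum n k.+1.
Proof.
elim/ltn_ind: n k => -[|[|n]] IH k le_kn; first by move: le_kn; rewrite doubleS.
  have -> : k = 0%N by lia.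
  by rewrite word_sum_nn word_sum_n0 ballot_sum_large // addr0.
case: (leqP k.+1.*2 n.+2) => [le_kn2 | gt_kn2]; last first.
  rewrite ballot_sum_large // addr0.
  have -> : n.+2 = (k.+1 + k)%N by lia.
  exact: word_sum_sym.
rewrite word_sum_recurrence ballot_sum_recurrence // (IH n.+1) //.
case: k le_kn le_kn2 => [|k] le_kn le_kn2.
  by rewrite !word_sum_n0 !ballot_sum_n0; ring.
rewrite word_sum_recurrence (IH n.+1 _ k) //; last lia.
by rewrite (IH n _ k) //; ring.
Qed.

(** Telescoping of [word_sumS], starting from the common value 1 at j = 0. *)
Lemma word_sum_ballot n j : (j.*2 <= n)%N ->
  word_sum n j = \sum_(k < j.+1) ballot_sum n k.
Proof.
elim: j => [|j IHj] le_jn; first by rewrite big_ord1 word_sum_n0 ballot_sum_n0.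
by rewrite big_ord_recr /= -IHj ?word_sumS //; lia.
Qed.

Lemma sum_word_sum (r : nat -> nat) n :
  \sum_(j < n.+1) word_sum n j *+ r j =
  \sum_(k < n./2.+1) ballot_sum n k *+ (\sum_(k <= j < (n - k).+1) r j).
Proof.
have word_sumE j : (j <= n)%N ->
    word_sum n j = \sum_(k < n./2.+1 | (k <= j <= n - k)%N) ballot_sum n k.
  (* The condition k <= j <= n - k is invariant under j -> n - j, as is [word_sum n j], so the lower
     half of the range suffices. *)
  wlog le_j : j / (j.*2 <= n)%N => [IH le_jn | _].
    case: (leqP j.*2 n) => [/IH-> // | lt_nj].
    have := word_sum_sym j (n - j); rewrite subnKC // => ->.
    rewrite IH ?leq_subr //; last lia.
    by apply: eq_bigl => k; have := ltn_ord k; lia.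
  rewrite word_sum_ballot // (big_ord_widen n./2.+1 (ballot_sum n)) //; last lia.
  by apply: eq_bigl => k; have := ltn_ord k; lia.
rewrite (eq_bigr (fun j : 'I_n.+1 =>
    \sum_(k < n./2.+1 | (k <= j <= n - k)%N) ballot_sum n k *+ r j)).
  rewrite (exchange_big_dep xpredT) //=; apply: eq_bigr => k _.
  rewrite (big_nat_widen _ _ n.+1) ?ltnS ?leq_subr //.
  rewrite (big_nat_widenl _ 0) // big_mkord -sumrMnr.
  by apply: eq_bigl => j; rewrite ltnS andbC.
by move=> j _; rewrite word_sumE ?sumrMnl // -ltnS.
Qed.
End BinaryWords.

(** * Two-row standard tableaux *)

(** When w is the word of a two-row tableau, this lists one row from left to right: the first for b
    = false, the second for b = true. *)
Definition positions (w : seq bool) (b : bool) : seq nat :=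
  [seq i <- iota 0 (size w) | nth false w i == b].

Lemma positions_sorted w b : sorted ltn (positions w b).
Proof. exact: (sorted_filter ltn_trans _ (iota_ltn_sorted _ _)). Qed.

Lemma mem_positions w b i :
  (i \in positions w b) = (i < size w)%N && (nth false w i == b).
Proof. by rewrite mem_filter mem_iota andbC. Qed.

Lemma count_positions w b p : (p <= size w)%N ->
  count (fun i => i < p)%N (positions w b) = count (pred1 b) (take p w).
Proof.
move=> le_p; have -> : take p w = mkseq (nth false w) p.
  apply: (@eq_from_nth _ false); rewrite ?size_mkseq ?size_takel // => i lt_i.
  by rewrite nth_take // nth_mkseq.
rewrite count_filter -(subnKC le_p) iotaD count_cat count_map add0n.
rewrite [X in (_ + X)%N](eq_in_count (a2 := pred0)) ?count_pred0 ?addn0.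
  by apply: eq_in_count => i /=; rewrite mem_iota => /andP[_ ->].
by move=> i; rewrite mem_iota /= => /andP[le_pi _]; rewrite ltnNge le_pi.
Qed.

Lemma size_positions w b : size (positions w b) = count (pred1 b) w.
Proof.
rewrite -[in RHS](take_size w) -count_positions //; apply/esym/eqP.
rewrite -all_count; apply/allP => i.
by rewrite mem_positions => /andP[].
Qed.

Lemma count_false w : count (pred1 false) w = (size w - count id w)%N.
Proof.
rewrite -(count_predC id w) addKn; apply: eq_count => b /=.
by case: b.
Qed.

Lemma count_true w : count (pred1 true) w = count id w.
Proof. by apply: eq_count => -[]. Qed.

Lemma ballotP w :
  reflect (forall p, (p <= size w)%N ->
     (count (fun i => i < p)%N (positions w true) <=
      count (fun i => i < p)%N (positions w false))%N)
    (ballot w).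
Proof.
have prefixE p : (p <= size w)%N ->
    ((count id (take p w)).*2 <= p)%N =
    (count (fun i => i < p)%N (positions w true) <=
     count (fun i => i < p)%N (positions w false))%N.
  move=> le_p; rewrite !count_positions // count_true count_false size_takel //.
  by have := count_size id (take p w); rewrite size_takel //; move: (count _ _); lia.
apply: (iffP forallP) => [bal p le_p | bal p].
  by have := bal (Ordinal (le_p : (p < (size w).+1)%N)); rewrite prefixE.
by rewrite prefixE ?bal // -ltnS.
Qed.

(** In an increasing list the elements below p form an initial segment. This converts prefix counts
    of a word into comparisons of tableau entries. *)
Lemma nth_sorted_lt s p j : sorted ltn s -> (j < size s)%N ->
  (nth 0%N s j < p)%N = (j < count (fun i => i < p)%N s)%N.
Proof.
elim: s j => //= x s IHs j; rewrite path_sortedE; last exact: ltn_trans.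
case/andP=> /allP gt_x sorted_s; case: (ltnP x p) => [lt_xp | le_px].
  by case: j => [|j] lt_j; rewrite ?add1n ?ltnS //= ?lt_xp // IHs.
have -> : count (fun i => i < p)%N s = 0%N.
  apply/eqP; rewrite -leqn0 leqNgt -has_count; apply/hasPn => i /gt_x /= lt_xi.
  by rewrite -leqNgt (leq_trans le_px) // ltnW.
rewrite addn0 /=; case: j => [|j] lt_j; first by rewrite ltnNge le_px.
have /gt_x/= lt_x := mem_nth 0%N (lt_j : (j < size s)%N).
by rewrite ltnNge (leq_trans le_px) // ltnW.
Qed.

Lemma cell_inj sh (c c' : cell sh) :
  crow c = crow c' -> ccol c = ccol c' -> c = c'.
Proof.
case: c c' => [r j] [r' j']; rewrite /crow /ccol /= => /val_inj e_r.
by case: r' / e_r j' => j' /val_inj->.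
Qed.

Lemma SYT_inj sh n (T : {ffun cell sh -> 'I_n}) : T \in SYT sh n -> injective T.
Proof.
move=> T_syt c c' eqT; move: T_syt; rewrite inE => /and3P[/forallP/(_ (T c))/cards1P[c0 e_c0] _ _].
have : c \in [set c1 | T c1 == T c] by rewrite inE.
have : c' \in [set c1 | T c1 == T c] by rewrite inE eqT.
by rewrite e_c0 !inE => /eqP-> /eqP->.
Qed.

Lemma SYT_surj sh n (T : {ffun cell sh -> 'I_n}) :
  T \in SYT sh n -> forall i, exists c, T c = i.
Proof.
move=> T_syt i; move: T_syt; rewrite inE => /and3P[/forallP/(_ i)/cards1P[c0 e_c0] _ _].
by exists c0; apply/eqP; have := set11 c0; rewrite -e_c0 inE.
Qed.

Section TwoRow.
Variables n k : nat.
Hypothesis le_kn : (k.*2 <= n)%N.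
Local Notation sh := (two_row n k).

Lemma crow_two_row (c : cell sh) : (crow c < 2)%N.
Proof. exact: (ltn_ord (tag c)). Qed.

Definition second_row_word (T : {ffun cell sh -> 'I_n}) : n.-tuple bool :=
  [tuple [exists c, (T c == i) && (crow c == 1%N)] | i < n].

Section Tableau.
Variable T : {ffun cell sh -> 'I_n}.
Hypothesis T_syt : T \in SYT sh n.

Lemma nth_second_row_word c :
  nth false (second_row_word T) (T c) = (crow c == 1%N).
Proof.
rewrite -tnth_nth tnth_mktuple.
apply/existsP/idP => [[c' /andP[/eqP/(SYT_inj T_syt)-> //]] | row_c].
by exists c; rewrite eqxx.
Qed.

(** Both lists are strictly increasing and have the same members, so they coincide; thus the word
    determines each row. *)
Lemma row_positions (r : 'I_2) :
  [seq val (T (existT _ r j)) | j <- enum 'I_(nth 0%N sh r)] =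
  positions (second_row_word T) (val r == 1%N).
Proof.
apply: (irr_sorted_eq ltn_trans ltnn); last 1 first.
- move=> i; rewrite mem_positions size_tuple; apply/mapP/andP => [[j _ ->] | [lt_i /eqP w_i]].
    by rewrite nth_second_row_word; split; rewrite ?ltn_ord ?eqxx.
  have [[r' j] T_c] := SYT_surj T_syt (Ordinal lt_i).
  have /= := nth_second_row_word (existT _ r' j); rewrite T_c /= w_i /crow /= => e_r.
  have {}e_r : r' = r.
    by move: e_r; case: (r) (r') => [[|[|]] // ?] [[|[|]] // ?] //= _; apply: val_inj.
  by case: r / e_r w_i => _; exists j; rewrite ?mem_enum ?T_c.
- have incr : {homo (fun j => val (T (existT _ r j))) : i j / (i < j)%N >-> (i < j)%N}.
    move=> i j lt_ij; move: T_syt; rewrite inE => /and3P[_ /forallP/(_ (existT _ r i))].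
    by move=> /forallP/(_ (existT _ r j)); rewrite /crow /ccol eqxx lt_ij.
  apply: (homo_sorted incr).
  by have := iota_ltn_sorted 0 (nth 0%N sh r); rewrite -val_enum_ord sorted_map.
exact: positions_sorted.
Qed.

Lemma SYT_nth c :
  nth 0%N (positions (second_row_word T) (crow c == 1%N)) (ccol c) = T c.
Proof.
case: c => r j; rewrite /crow /ccol /= -row_positions.
by rewrite (nth_map j) ?size_enum_ord // nth_ord_enum.
Qed.

Lemma count_second_row_word : count id (second_row_word T) = k.
Proof.
rewrite -count_true -size_positions -(row_positions (Ordinal (ltnSn 1))).
by rewrite size_map size_enum_ord.
Qed.

(** If the prefix of length p had j zeros and more than j ones, the second-row entry in column j
    would be below p and the entry above it would not, against column strictness. Column j exists in
    the first row by [le_kn]. *)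
Lemma ballot_second_row_word : ballot (second_row_word T).
Proof.
apply/ballotP => p _; set w := second_row_word T.
rewrite leqNgt; apply/negP => lt_c.
set j := count _ (positions w false) in lt_c.
have lt_jk : (j < k)%N.
  rewrite (leq_trans lt_c) // -[X in (_ <= X)%N]count_second_row_word -count_true.
  by rewrite -size_positions count_size.
have lt_jk' : (j < n - k)%N by lia.
pose c0 : cell sh := existT _ (Ordinal (isT : 0 < 2)%N) (Ordinal lt_jk').
pose c1 : cell sh := existT _ (Ordinal (isT : 1 < 2)%N) (Ordinal lt_jk).
have lt_T : (T c0 < T c1)%N.
  move: T_syt; rewrite inE => /and3P[_ _ /forallP/(_ c0)/forallP/(_ c1)].
  by rewrite /crow /ccol /= eqxx.
have := ltnn j; rewrite {2}/j -nth_sorted_lt ?positions_sorted //; last first.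
  by rewrite size_positions count_false count_second_row_word size_tuple.
rewrite -[X in nth _ (positions _ X)]/(crow c0 == 1%N) -[X in nth _ _ X]/(ccol c0) SYT_nth.
move: lt_c; rewrite -nth_sorted_lt ?positions_sorted //; last first.
  by rewrite size_positions count_true count_second_row_word.
rewrite -[X in nth _ (positions _ X)]/(crow c1 == 1%N) -[X in nth _ _ X]/(ccol c1) SYT_nth.
by move=> lt_p; rewrite (ltn_trans lt_T lt_p).
Qed.

(** With only two rows, a descent goes from the first row to the second, which is an ascent 01 of
    the word. *)
Lemma Des_second_row_word (R : comPzRingType) (q : nat -> R) :
  \prod_(i in Des T) q i = ascent_weight q n (second_row_word T).
Proof.
rewrite big_mkcond; apply: eq_bigr => i _; congr (if _ then _ else _).
have [c T_c] := SYT_surj T_syt (lo i); have [c' T_c'] := SYT_surj T_syt (hi i).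
have := nth_second_row_word c; rewrite T_c /= => ->.
have := nth_second_row_word c'; rewrite T_c' /= => ->.
have := crow_two_row c; have := crow_two_row c' => lt_c' lt_c.
rewrite inE; apply/existsP/idP => [[d /existsP[d' /and3P[]]] | rows].
  by rewrite -T_c -T_c' => /eqP/(SYT_inj T_syt)-> /eqP/(SYT_inj T_syt)->; lia.
by exists c; apply/existsP; exists c'; rewrite T_c T_c' !eqxx /=; lia.
Qed.

End Tableau.

Lemma second_row_word_inj : {in SYT sh n &, injective second_row_word}.
Proof.
move=> T T' T_syt T'_syt eq_w; apply/ffunP => c; apply: val_inj.
by rewrite /= -!SYT_nth // eq_w.
Qed.

Lemma second_row_word_image :
  second_row_word @: SYT sh n =
  [set w : n.-tuple bool | (count id w == k) && ballot w].
Proof.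
apply/setP => w; rewrite inE; apply/imsetP/andP => [[T T_syt ->] | [/eqP count_w bal_w]].
  by rewrite count_second_row_word ?ballot_second_row_word.
(* The preimage of w puts the positions of its zeros in the first row and those of its ones in the
   second, in increasing order. *)
pose s (c : cell sh) := positions w (crow c == 1%N).
have col_lt c : (ccol c < size (s c))%N.
  rewrite /s size_positions; case: c => -[[|[|//]] ? j]; rewrite /crow /ccol /=.
    by rewrite count_false size_tuple count_w ltn_ord.
  by rewrite count_true count_w ltn_ord.
have entry_lt c : (nth 0%N (s c) (ccol c) < n)%N.
  by have := mem_nth 0%N (col_lt c); rewrite mem_positions size_tuple => /andP[].
pose T : {ffun cell sh -> 'I_n} := [ffun c => Ordinal (entry_lt c)].
have T_nth c : T c = nth 0%N (s c) (ccol c) :> nat by rewrite ffunE.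
have w_T c : nth false w (T c) = (crow c == 1%N).
  rewrite T_nth; have := mem_nth 0%N (col_lt c).
  by rewrite mem_positions => /andP[_ /eqP].
have T_inj : injective T.
  move=> c c' eqT; have e_row : crow c = crow c'.
    have := w_T c; rewrite eqT w_T.
    by have := crow_two_row c; have := crow_two_row c'; lia.
  apply: cell_inj => //; apply/eqP.
  rewrite -(@nth_uniq _ 0%N (s c)) ?col_lt //.
  - by rewrite -T_nth {1}/s e_row -T_nth eqT.
  - by rewrite /s e_row col_lt.
  - exact: (sorted_uniq ltn_trans ltnn (positions_sorted _ _)).
have T_surj i : exists c, T c = i.
  (* The cell labelled i has the letter at i as its row, and the rank of i among the positions of
     that letter as its column. *)
  pose b := nth false w i; pose j := index (val i) (positions w b).
  have i_in : val i \in positions w b by rewrite mem_positions size_tuple ltn_ord eqxx.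
  have lt_j : (j < nth 0%N sh b)%N.
    rewrite (leq_trans (_ : j < size (positions w b))%N) ?index_mem //.
    rewrite size_positions; case: (b); rewrite ?count_true ?count_false ?count_w //.
    by rewrite size_tuple.
  have lt_b : (b < 2)%N by case: (b).
  exists (existT _ (Ordinal lt_b) (Ordinal lt_j)); apply: val_inj.
  by rewrite /= T_nth /s /crow /ccol /= eqb1 nth_index.
exists T.
  rewrite inE; apply/and3P; split.
  - apply/forallP => i; have [c T_c] := T_surj i.
    apply/cards1P; exists c; apply/setP => c'; rewrite !inE -T_c.
    by rewrite (inj_eq T_inj).
  - apply/forallP => c; apply/forallP => c'; apply/implyP => /andP[/eqP e_row lt_c].
    rewrite !T_nth /s e_row; apply: (sorted_ltn_nth ltn_trans) => //.
    + exact: positions_sorted.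
    + by rewrite inE -e_row; apply: col_lt.
    + by rewrite inE; apply: col_lt.
  - apply/forallP => c; apply/forallP => c'; apply/implyP => /andP[/eqP e_col lt_c].
    have row_c' : crow c' = 1%N by have := crow_two_row c'; lia.
    have row_c : crow c = 0%N by lia.
    have ne_T : T c != T c' :> nat.
      apply/eqP => eqT; have := w_T c; rewrite eqT w_T row_c' row_c; done.
    rewrite ltn_neqAle ne_T -ltnS [in X in (X < _)%N]T_nth.
    have := col_lt c; rewrite /s row_c => lt_col.
    rewrite nth_sorted_lt ?positions_sorted //.
    have size_true : size (positions w true) = k.
      by rewrite size_positions count_true count_w.
    have lt_ck : (ccol c' < size (positions w true))%N.
      by have := col_lt c'; rewrite /s row_c'.
    (* The prefix ending at [T c'] contains more than [ccol c'] ones, hence more than [ccol c']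
       zeros, which puts [T c] inside it; [ne_T] then makes the inequality strict. *)
    have := ballotP _ bal_w (T c').+1; rewrite size_tuple ltn_ord => /(_ isT).
    move=> le_c; rewrite e_col; apply: leq_trans le_c; rewrite -nth_sorted_lt ?positions_sorted //.
    by rewrite T_nth /s row_c'.
apply: eq_from_tnth => i; have [c T_c] := T_surj i.
rewrite !(tnth_nth false) -T_c w_T nth_mktuple.
apply/idP/existsP => [row_c | [c' /andP[/eqP/T_inj-> //]]].
by exists c; rewrite eqxx.
Qed.

Lemma sum_SYT_two_row (R : comPzRingType) (q : nat -> R) :
  \sum_(T in SYT sh n) \prod_(i in Des T) q i = ballot_sum q n k.
Proof.
transitivity (\sum_(w in second_row_word @: SYT sh n) ascent_weight q n w).
  rewrite big_imset; last exact: second_row_word_inj.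
  by apply: eq_bigr => T T_syt; rewrite Des_second_row_word.
by apply: eq_bigl => w; rewrite second_row_word_image inE.
Qed.

End TwoRow.

(** * Non-crossing partitions and their singletons *)

Lemma partition_setTP (T : finType) (P : {set {set T}}) :
  reflect [/\ set0 \notin P, forall x, exists2 B, B \in P & x \in B
            & forall x B B', B \in P -> B' \in P -> x \in B -> x \in B' -> B = B']
    (partition P [set: T]).
Proof.
apply: (iffP and3P) => [[/eqP cov /trivIsetP triv P0] | [P0 cov uniq_block]].
  split=> // [x | x B B' PB PB' Bx B'x]; first by apply/bigcupP; rewrite -/(cover P) cov inE.
  apply/eqP; apply: contraTT isT => /(triv _ _ PB PB')/pred0P/(_ x)/=.
  by rewrite Bx B'x.
split=> //.
  by rewrite eqEsubset subsetT; apply/subsetP => x _; apply/bigcupP; apply: cov.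
apply/trivIsetP => B B' PB PB'; apply: contraR => /pred0Pn[x /andP[Bx B'x]].
by apply/eqP; apply: uniq_block Bx B'x.
Qed.

(** The enumeration of A filters the increasing enumeration of 'I_n. Relabelling by it therefore
    respects the order conditions defining arcs and crossings. *)
Lemma enum_val_ltn n (A : {set 'I_n}) :
  {mono @enum_val _ A : i j / (i < j)%N >-> (i < j)%N}.
Proof.
suff incr : {homo @enum_val _ A : i j / (i < j)%N >-> (i < j)%N}.
  move=> i j; case: (ltngtP i j) => [/incr // | /incr lt_ji | /val_inj->].
    by apply/negbTE; rewrite -leqNgt ltnW.
  by rewrite ltnn.
move=> i j lt_ij; have x0 := enum_val i.
have sorted_A : sorted ltn [seq val x | x <- enum A].
  rewrite sorted_map {1}/enum_mem -enumT.
  apply: sorted_filter; first by move=> ? ? ?; apply: ltn_trans.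
  by have := iota_ltn_sorted 0 n; rewrite -val_enum_ord sorted_map.
have := sorted_ltn_nth ltn_trans (val x0) sorted_A.
move=> /(_ (val i) (val j)); rewrite !inE size_map -!cardE !ltn_ord => /(_ isT isT lt_ij).
by rewrite !(nth_map x0) -?cardE ?ltn_ord // -!(enum_val_nth x0).
Qed.

(** * Inserting a prescribed set of singletons into a partition *)

Section FillSingletons.
Variables (n : nat) (S : {set 'I_n}).
Local Notation A := (~: S).
Local Notation h := (@enum_val _ (mem A)).

(** Q is carried to the complement of S by the increasing bijection [h]. This reaches every
    partition with singleton set S exactly once, from a singleton-free Q. *)
Definition fill_singletons (Q : {set {set 'I_#|A|}}) : {set {set 'I_n}} :=
  [set h @: (B : {set 'I_#|A|}) | B in Q] :|: [set [set i] | i in S].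

Lemma fill_singletonsP (Q : {set {set 'I_#|A|}}) C :
  reflect ((exists2 B, B \in Q & C = h @: (B : {set _})) \/ (exists2 i, i \in S & C = [set i]))
    (C \in fill_singletons Q).
Proof.
rewrite inE; apply: (iffP orP) => [[/imsetP|/imsetP]|[Q_C|S_C]]; [by left|by right| |].
- by left; apply/imsetP.
- by right; apply/imsetP.
Qed.

Lemma enum_val_notin i : h i \notin S.
Proof. by have := enum_valP i; rewrite !inE. Qed.

Lemma mem_enum_val_imset (B : {set 'I_#|A|}) i : (h i \in h @: B) = (i \in B).
Proof. exact: mem_imset enum_val_inj. Qed.

Lemma enum_val_ex x : x \notin S -> exists i, x = h i.
Proof.
by move=> Sx; have Ax : x \in A; [rewrite inE | exists (enum_rank_in Ax x); rewrite enum_rankK_in].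
Qed.

Lemma imset_enum_val_neq1 (B : {set 'I_#|A|}) x : x \in S -> x \notin h @: B.
Proof. by move=> Sx; apply/imsetP => -[i _ e]; have := enum_val_notin i; rewrite -e Sx. Qed.

Lemma fill_singletons_inj : injective fill_singletons.
Proof.
suff sub Q Q' : fill_singletons Q = fill_singletons Q' -> Q \subset Q'.
  by move=> Q Q' e; apply/eqP; rewrite eqEsubset !sub.
move=> e; apply/subsetP => B QB.
have : h @: B \in fill_singletons Q' by rewrite -e; apply/fill_singletonsP; left; exists B.
case/fill_singletonsP => [[B' Q'B' /(imset_inj enum_val_inj)-> //] | [x Sx eB]].
by have := imset_enum_val_neq1 B Sx; rewrite eB set11.
Qed.

Lemma partition_fill Q :
  partition (fill_singletons Q) setT = partition Q setT.
Proof.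
apply/partition_setTP/partition_setTP => -[P0 cov uniq_block]; split.
- apply: contra P0 => Q0; apply/fill_singletonsP; left; exists set0 => //.
  by rewrite imset0.
- move=> i; have [C /fill_singletonsP[[B QB ->]|[x Sx ->]]] := cov (h i).
    by rewrite mem_enum_val_imset; exists B.
  by rewrite inE => /eqP e; have := enum_val_notin i; rewrite e Sx.
- move=> i B B' QB QB' Bi B'i; apply: (imset_inj enum_val_inj).
  by apply: (uniq_block (h i)); rewrite ?mem_enum_val_imset //;
    apply/fill_singletonsP; left; [exists B | exists B'].
- apply/fill_singletonsP => -[[B QB /esym/eqP]|[x _ /setP/(_ x)]]; last by rewrite !inE eqxx.
  by rewrite imset_eq0 => /eqP eB; rewrite -eB QB in P0.
- move=> x; case: (boolP (x \in S)) => [Sx | /enum_val_ex[i ->]].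
    by exists [set x]; rewrite ?set11 //; apply/fill_singletonsP; right; exists x.
  have [B QB Bi] := cov i; exists (h @: B); rewrite ?mem_enum_val_imset //.
  by apply/fill_singletonsP; left; exists B.
- move=> x C C' /fill_singletonsP[[B QB ->]|[y Sy ->]]
    /fill_singletonsP[[B' QB' ->]|[y' Sy' ->]].
  + case/imsetP=> i Bi ->; rewrite mem_enum_val_imset => B'i.
    by rewrite (uniq_block _ _ _ QB QB' Bi B'i).
  + move=> Bx; rewrite inE => /eqP ex; rewrite ex in Bx.
    by have := imset_enum_val_neq1 B Sy'; rewrite Bx.
  + rewrite inE => /eqP-> By.
    by have := imset_enum_val_neq1 B' Sy; rewrite By.
  + by rewrite !inE => /eqP-> /eqP->.
Qed.

(** The gap condition of an arc only concerns elements of its own block, so singletons inserted in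
    between do not affect it. *)
Lemma is_arc_fill Q i j : is_arc (fill_singletons Q) (h i) (h j) = is_arc Q i j.
Proof.
rewrite /is_arc enum_val_ltn; case: (ltnP i j) => //= lt_ij.
apply/existsP/existsP => [[C /and4P[PC Ci Cj /forallP gap]] | [B /and4P[QB Bi Bj /forallP gap]]].
  case/fill_singletonsP: PC Ci Cj gap => [[B QB ->]|[x Sx ->]]; last first.
    by rewrite !inE => /eqP e; have := enum_val_notin i; rewrite e Sx.
  rewrite !mem_enum_val_imset => Bi Bj gap; exists B; rewrite QB Bi Bj /=.
  apply/forallP => l; apply/implyP => Bl.
  by have := gap (h l); rewrite mem_enum_val_imset Bl !enum_val_ltn.
exists (h @: B); rewrite !mem_enum_val_imset Bi Bj /=; apply/andP; split.
  by apply/fill_singletonsP; left; exists B.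
apply/forallP => y; apply/implyP => /imsetP[l Bl ->]; rewrite !enum_val_ltn.
by have := gap l; rewrite Bl.
Qed.

Lemma is_arc_fill_ex Q x y : is_arc (fill_singletons Q) x y ->
  exists i j, x = h i /\ y = h j.
Proof.
case/andP=> lt_xy /existsP[C /and4P[/fill_singletonsP[[B QB ->]|[z Sz ->]]]].
  by case/imsetP=> i _ -> /imsetP[j _ ->]; exists i, j.
by rewrite !inE => /eqP ex /eqP ey; rewrite ex ey ltnn in lt_xy.
Qed.

Lemma noncrossing_fill Q : noncrossing (fill_singletons Q) = noncrossing Q.
Proof.
rewrite /noncrossing; apply/'forall_'forall_'forall_forallP/'forall_'forall_'forall_forallP.
  move=> nc i1 j1 i2 j2.
  by have := nc (h i1) (h j1) (h i2) (h j2); rewrite !is_arc_fill !enum_val_ltn.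
move=> nc x1 y1 x2 y2; apply/implyP => /andP[arc1 arc2].
have [i1 [j1 [e1 f1]]] := is_arc_fill_ex arc1.
have [i2 [j2 [e2 f2]]] := is_arc_fill_ex arc2.
move: arc1 arc2; rewrite e1 f1 e2 f2 !is_arc_fill !enum_val_ltn => arc1 arc2.
by have := nc i1 j1 i2 j2; rewrite arc1 arc2.
Qed.

Lemma Sing_fill Q : (Sing (fill_singletons Q) == S) = (Sing Q == set0).
Proof.
apply/eqP/eqP => [eS | Q0].
  apply/setP => i; rewrite !inE; apply/negbTE/negP => Qi.
  have : h i \in Sing (fill_singletons Q).
    by rewrite inE; apply/fill_singletonsP; left; exists [set i]; rewrite ?imset_set1.
  by rewrite eS (negbTE (enum_val_notin i)).
apply/setP => x; rewrite inE; apply/fill_singletonsP/idP => [[[B QB eB]|[y Sy]] | Sx]; last first.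
- by right; exists x.
- by move/set1_inj->.
have /imsetP[i Bi ex] : x \in h @: B by rewrite -eB set11.
suff : i \in Sing Q by rewrite Q0 inE.
rewrite inE -(_ : B = [set i]) //; apply: (imset_inj enum_val_inj).
by rewrite -eB imset_set1 ex.
Qed.

Lemma card_NC_Sing : #|[set P in NC n | Sing P == S]| = riordan #|A|.
Proof.
rewrite /riordan -(card_imset _ fill_singletons_inj); apply: eq_card => P.
apply/idP/imsetP => [|[Q]]; last first.
  by rewrite !inE => + ->; rewrite partition_fill noncrossing_fill Sing_fill.
move=> P_in; pose Q := [set B : {set 'I_#|A|} | h @: B \in P].
have eP : P = fill_singletons Q.
  move: P_in; rewrite !inE => /andP[/andP[/partition_setTP[_ _ uniq_block] _] /eqP eS].
  have single x : x \in S -> [set x] \in P by rewrite -eS inE.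
  apply/setP => C; apply/idP/fill_singletonsP => [PC | [[B] | [x Sx ->]]]; last 2 first.
  - by rewrite inE => ? ->.
  - exact: single.
  (* A block meeting S at x must be the block {x}; a block avoiding S lies in the range of [h] and
     is the image of its preimage. *)
  case: (set_0Vmem (C :&: S)) => [CS0 | [x /setIP[Cx Sx]]]; last first.
    by right; exists x => //; apply: (uniq_block x); rewrite ?set11 ?single.
  left; have eC : C = h @: (h @^-1: C).
    apply/setP => x; apply/idP/imsetP => [Cx | [i]]; last by rewrite inE => ? ->.
    have /enum_val_ex[i ex] : x \notin S.
      by apply/negP => Sx; have := in_set0 x; rewrite -CS0 inE Cx Sx.
    by exists i; rewrite // inE -ex.
  by exists (h @^-1: C); rewrite // inE -eC.
exists Q => //; move: P_in; rewrite eP !inE partition_fill noncrossing_fill.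
by rewrite Sing_fill.
Qed.

End FillSingletons.

Lemma sum_NC_Sing (V : nmodType) n (F : {set 'I_n} -> V) :
  \sum_(P in NC n) F (Sing P) = \sum_(S : {set 'I_n}) F S *+ riordan #|~: S|.
Proof.
rewrite (partition_big (@Sing n) xpredT) //=; apply: eq_bigr => S _.
rewrite (eq_bigr (fun=> F S)) => [|P /andP[_ /eqP-> //]].
by rewrite -card_NC_Sing -sumr_const; apply: eq_bigl => P; rewrite !inE.
Qed.

Lemma sum_NC_Desing (R : comPzRingType) (q : nat -> R) n :
  \sum_(P in NC n) \prod_(i in Desing P) q i =
  \sum_(j < n.+1) word_sum q n j *+ riordan j.
Proof.
pose F (S : {set 'I_n}) := \prod_(i : 'I_n.-1 | (lo i \in S) && (hi i \notin S)) q i.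
rewrite (eq_bigr (fun P => F (Sing P))); last first.
  by move=> P _; apply: eq_bigl => i; rewrite inE.
(* Zeros mark singletons: elements of [Desing] become ascents, and the number of ones is the size of
   the complement. *)
pose word_set (w : n.-tuple bool) : {set 'I_n} := [set i | ~~ tnth w i].
have bij_word_set : bijective word_set.
  exists (fun S : {set 'I_n} => [tuple i \notin S | i < n]).
    by move=> w; apply: eq_from_tnth => i; rewrite tnth_mktuple inE negbK.
  by move=> S; apply/setP => i; rewrite inE tnth_mktuple negbK.
rewrite sum_NC_Sing (reindex word_set) /=; last exact: onW_bij.
have count_word (w : n.-tuple bool) : #|~: word_set w| = count id w.
  rewrite -sum1_card -sum1_count big_tuple.
  by apply: eq_bigl => i; rewrite !inE negbK.
have count_lt (w : n.-tuple bool) : (count id w < n.+1)%N.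
  by rewrite ltnS -{2}(size_tuple w) count_size.
rewrite (partition_big (fun w => Ordinal (count_lt w)) xpredT) //=.
apply: eq_bigr => j _; rewrite -sumrMnl; apply: eq_big => w; first by [].
move=> /eqP <-; rewrite count_word; congr (_ *+ _).
rewrite /F /ascent_weight big_mkcond; apply: eq_bigr => i _.
by rewrite !inE negbK !(tnth_nth false).
Qed.

(** This reconciles the case k = 1 of [dcoef], whose sum starts at 2, with the uniform sum starting
    at k. *)
Lemma riordan1 : riordan 1 = 0%N.
Proof.
apply/eqP; rewrite cards_eq0; apply/eqP/setP => P; rewrite !inE.
apply/negP => /andP[/andP[/partition_setTP[_ /(_ ord0)[B PB B0] _] _] /eqP/setP/(_ ord0)].
rewrite !inE -(_ : B = [set ord0]) ?PB //.
by apply/setP => i; rewrite (ord1 i) B0 set11.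
Qed.

Lemma sum_NC_SYT (R : comPzRingType) (q : nat -> R) n :
  \sum_(P in NC n) \prod_(i in Desing P) q i =
  \sum_(k < n./2.+1)
     (\sum_(T in SYT (two_row n k) n) \prod_(i in Des T) q i) *+ dcoef n k.
Proof.
rewrite sum_NC_Desing sum_word_sum; apply: eq_bigr => k _.
rewrite sum_SYT_two_row; last by have := ltn_ord k; lia.
congr (_ *+ _); rewrite /dcoef; case: eqP => // k1.
have n_gt1 : (1 < n)%N by have := ltn_ord k; lia.
rewrite k1 big_ltn ?riordan1 ?add0n; last lia.
by rewrite subn1 prednK // ltnW.
Qed.

(** * Standardization *)

Section Standardization.
Variables (sh : seq nat) (n : nat).
Hypothesis card_cell : #|cell sh| = n.
Implicit Types (T : {ffun cell sh -> 'I_n}) (t : {ffun cell sh -> nat}).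

Definition semistandard t : bool :=
  [forall c, forall c', (crow c == crow c') && (ccol c < ccol c')%N ==> (t c <= t c')%N] &&
  [forall c, forall c', (ccol c == ccol c') && (crow c < crow c')%N ==> (t c < t c')%N].

(** Read in the order of the labels of T, the entries of t form a word contributing to
    [fundamental (Des T)]. *)
Definition standardizes T t : bool :=
  [forall c, forall c', (T c <= T c')%N ==> (t c <= t c')%N] &&
  [forall c, forall c', (T c' == (T c).+1 :> nat) && (crow c < crow c')%N ==> (t c < t c')%N].

(* Cells with equal entries are numbered from the bottom row to the top row,
   and from left to right inside a row. *)
Definition cell_lt t (c c' : cell sh) : bool :=
  [|| t c < t c', (t c == t c') && (crow c' < crow c)
    | [&& t c == t c', crow c == crow c' & ccol c < ccol c']]%N.

Definition cell_rank t c := #|[set c' | cell_lt t c' c]|.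

Lemma cell_lt_trans t c1 c2 c3 : cell_lt t c1 c2 -> cell_lt t c2 c3 -> cell_lt t c1 c3.
Proof. rewrite /cell_lt; lia. Qed.

Lemma cell_lt_irr t c : cell_lt t c c = false.
Proof. rewrite /cell_lt; lia. Qed.

Lemma cell_lt_total t c c' : c != c' -> cell_lt t c c' || cell_lt t c' c.
Proof.
move=> ne_c; have : ~ (crow c = crow c' /\ ccol c = ccol c').
  by case=> e_row e_col; case/eqP: ne_c; apply: cell_inj.
rewrite /cell_lt; lia.
Qed.

Lemma cell_rank_lt t c : (cell_rank t c < n)%N.
Proof.
rewrite -card_cell -cardsT; apply: proper_card; apply/properP; split.
  exact: subsetT.
by exists c; rewrite !inE // cell_lt_irr.
Qed.

Lemma cell_rank_homo t c c' : cell_lt t c c' -> (cell_rank t c < cell_rank t c')%N.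
Proof.
move=> lt_c; apply: proper_card; apply/properP; split.
  by apply/subsetP => d; rewrite !inE => /cell_lt_trans; apply.
by exists c; rewrite !inE // cell_lt_irr.
Qed.

Lemma cell_rank_mono t c c' : (cell_rank t c < cell_rank t c')%N = cell_lt t c c'.
Proof.
apply/idP/idP => [lt_r | /cell_rank_homo //].
case: (eqVneq c c') => [e | /(cell_lt_total t)/orP[// | /cell_rank_homo]].
  by rewrite e ltnn in lt_r.
by rewrite ltnNge ltnW.
Qed.

Lemma SYT_card_lt T c : T \in SYT sh n -> #|[set c' | (T c' < T c)%N]| = T c.
Proof.
move=> T_syt; rewrite -(card_imset _ (SYT_inj T_syt)).
rewrite (_ : _ @: _ = [set i : 'I_n | (i < T c)%N]).
  by rewrite -sum1dep_card -(big_ord_widen _ (fun=> 1%N)) ?sum1_card ?card_ord // ltnW.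
apply/setP => i; rewrite inE; apply/imsetP/idP => [[c']|].
  by rewrite inE => ? ->.
by have [c' <-] := SYT_surj T_syt i; exists c'; rewrite ?inE.
Qed.

(* The labels between two cells with equal [t]-entries all carry that entry,
   so no descent occurs among them and the row index can only decrease. *)
Lemma standardizes_row T t c c' : T \in SYT sh n -> standardizes T t ->
  (T c <= T c')%N -> t c = t c' -> (crow c' <= crow c)%N.
Proof.
move=> T_syt /andP[/'forall_'forall_implyP le_t /'forall_'forall_implyP lt_t] le_T.
move: {2}(T c' - T c)%N (erefl (T c' - T c)%N) => d.
elim: d c' le_T => [|d IHd] c' le_T e_d e_t.
  have /(SYT_inj T_syt)-> // : T c = T c'.
    by apply: ord_inj; apply/eqP; rewrite eqn_leq le_T -subn_eq0 e_d.
have lt_n : (T c + d < n)%N by have := ltn_ord (T c'); lia.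
have [c2 T_c2] := SYT_surj T_syt (Ordinal lt_n).
have val_c2 : (T c2 = T c + d :> nat)%N by rewrite T_c2.
have le1 : (t c <= t c2)%N by apply: le_t; lia.
have le2 : (t c2 <= t c')%N by apply: le_t; lia.
have le_row : (crow c2 <= crow c)%N by apply: IHd; lia.
apply: leq_trans le_row; rewrite leqNgt; apply/negP => lt_row.
have : (t c2 < t c')%N by apply: lt_t; rewrite lt_row andbT; apply/eqP; lia.
by rewrite -e_t ltnNge le1.
Qed.

Lemma standardizes_semistandard T t :
  T \in SYT sh n -> standardizes T t -> semistandard t.
Proof.
move=> T_syt T_t; have := T_syt; rewrite inE => /and3P[_ row_lt col_lt].
have /andP[/'forall_'forall_implyP le_t _] := T_t.
apply/andP; split; apply/'forall_'forall_implyP => c c' c_c'.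
  by apply: le_t; apply: ltnW; move: c c' c_c'; apply/'forall_'forall_implyP.
have lt_T : (T c < T c')%N by move: c c' c_c'; apply/'forall_'forall_implyP.
rewrite ltn_neqAle le_t ?andbT; last exact: ltnW.
apply/eqP => e_t; have := standardizes_row T_syt T_t (ltnW lt_T) e_t.
by move/andP: c_c' => [_]; lia.
Qed.

(** Uniqueness of the standardization: T is increasing for the total order [cell_lt t], where ties
    follow from [standardizes_row] and, within a row, from row strictness. Each label is then the
    rank of its cell. *)
Lemma standardizes_rank T t c :
  T \in SYT sh n -> standardizes T t -> T c = cell_rank t c :> nat.
Proof.
move=> T_syt T_t; rewrite -SYT_card_lt //; apply: eq_card => c1; rewrite !inE.
have := T_syt; rewrite inE => /and3P[_ /'forall_'forall_implyP row_lt _].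
have /andP[/'forall_'forall_implyP le_t _] := T_t.
have homo_T d d' : cell_lt t d d' -> (T d < T d')%N.
  move=> lt_d; rewrite ltnNge; apply/negP => le_T.
  have le_td := le_t _ _ le_T; have row_d := standardizes_row T_syt T_t le_T.
  have := row_lt d d'; move: lt_d; rewrite /cell_lt; lia.
apply/idP/idP => [lt_T | /homo_T //].
case: (eqVneq c1 c) => [e | /(cell_lt_total t)/orP[// | /homo_T]].
  by rewrite e ltnn in lt_T.
by rewrite ltnNge ltnW.
Qed.

Definition standardization t : {ffun cell sh -> 'I_n} :=
  [ffun c => Ordinal (cell_rank_lt t c)].

Lemma standardization_lt t c c' :
  (standardization t c < standardization t c')%N = cell_lt t c c'.
Proof. by rewrite !ffunE cell_rank_mono. Qed.

Lemma standardization_SYT t : semistandard t -> standardization t \in SYT sh n.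
Proof.
move=> /andP[/'forall_'forall_implyP row_le /'forall_'forall_implyP col_lt].
have inj_s : injective (standardization t).
  move=> c c' e_s; apply/eqP; apply: contraTT isT => /(cell_lt_total t).
  by rewrite -!standardization_lt e_s ltnn.
have [g _ gK] : bijective (standardization t).
  by apply: inj_card_bij; rewrite // card_ord card_cell.
rewrite inE; apply/and3P; split.
- apply/forallP => i; apply/cards1P; exists (g i); apply/setP => c; rewrite !inE.
  by rewrite -{1}(gK i) (inj_eq inj_s).
- apply/'forall_'forall_implyP => c c' c_c'; rewrite standardization_lt.
  by have := row_le c c' c_c'; move: c_c'; rewrite /cell_lt; lia.
- apply/'forall_'forall_implyP => c c' c_c'; rewrite standardization_lt.
  by have := col_lt c c' c_c'; rewrite /cell_lt; lia.
Qed.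

(** Ties are numbered from bottom to top, so a step to a lower row cannot occur between equal
    entries. *)
Lemma standardization_standardizes t : standardizes (standardization t) t.
Proof.
apply/andP; split; apply/'forall_'forall_implyP => c c'.
  by rewrite leqNgt standardization_lt /cell_lt; lia.
case/andP=> /eqP e_s; have : cell_lt t c c' by rewrite -standardization_lt e_s.
by rewrite /cell_lt; lia.
Qed.

(** Existence and uniqueness of the standardization, as a count ready for an exchange of sums over T
    and t. *)
Lemma card_standardizes t :
  #|[set T in SYT sh n | standardizes T t]| = semistandard t.
Proof.
case: (boolP (semistandard t)) => [ss_t | not_ss]; last first.
  apply/eqP; rewrite cards_eq0; apply/eqP/setP => T; rewrite in_set in_set0.
  by apply: contraNF not_ss => /andP[]; apply: standardizes_semistandard.
apply/eqP/cards1P; exists (standardization t); apply/setP => T.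
rewrite in_set1 in_set; apply/andP/eqP => [[T_syt T_t] | ->].
  by apply/ffunP => c; apply: val_inj; rewrite ffunE /= (standardizes_rank _ T_syt T_t).
by rewrite standardization_SYT // standardization_standardizes.
Qed.

End Standardization.

(** * Coefficients of generating series as finite sums *)

Section Fiber.
Variables (I : finType) (m : monom).

(** A map with monomial m takes its values in the support of m, so these maps form a finite list. It
    depends only on I and m, so series given by different sets are summed over the same list. *)
Definition fiber : seq {ffun I -> nat} :=
  [seq w <- [seq [ffun t => val (v t)] | v : {ffun I -> finsupp m}] | wmon w == m].

Lemma fiber_uniq : uniq fiber.
Proof.
apply: filter_uniq; rewrite map_inj_uniq ?enum_uniq // => v v' /ffunP e.
by apply/ffunP => t; apply: val_inj; have := e t; rewrite !ffunE.
Qed.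

Lemma mem_fiber w : (w \in fiber) = (wmon w == m).
Proof.
rewrite mem_filter; case: eqP => //= e_w; apply/mapP.
have w_in t : w t \in finsupp m.
  by rewrite -e_w /wmon (bigD1 t) //= mdomD mdomU in_fsetU in_fset1 eqxx.
exists [ffun t => [` w_in t]%fset]; first by rewrite mem_enum.
by apply/ffunP => t; rewrite !ffunE.
Qed.

Lemma gen_seriesE (A : set {ffun I -> nat}) (a : pred {ffun I -> nat}) :
    (forall w, reflect (A w) (a w)) ->
  gen_series A m = \sum_(w <- fiber) ((a w)%:R : int).
Proof.
move=> aP; rewrite /gen_series.
have r_uniq : uniq [seq w <- fiber | a w] by rewrite filter_uniq ?fiber_uniq.
rewrite (fsbigE _ _ r_uniq); last 2 first.
- by move=> w /=; rewrite mem_filter => /andP[/aP].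
- by move=> w /aP a_w; rewrite mem_filter a_w mem_fiber /= => /negbTE->.
rewrite big_filter_cond /= [LHS]big_mkcond; apply: eq_big_seq => w.
rewrite mem_fiber => ->.
have -> : (w \in A) = a w by apply/idP/aP => [/set_mem | /mem_set].
by rewrite andbb; case: (a w).
Qed.

End Fiber.

Definition weakly_increasing n (w : {ffun 'I_n -> nat}) : bool :=
  [forall i : 'I_n, forall j : 'I_n, (i <= j)%N ==> (w i <= w j)%N].

Lemma fundamentalE n (D : {set 'I_n.-1}) m :
  fundamental D m =
  \sum_(w <- fiber 'I_n m) (weakly_increasing w)%:R *
     \prod_(i in D) ((w (lo i) < w (hi i))%N%:R : int).
Proof.
rewrite /fundamental (@gen_seriesE _ _ _ (fun w => weakly_increasing w &&
    [forall i in D, w (lo i) < w (hi i)]%N)).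
  apply: eq_bigr => w _; rewrite -mulnb natrM; congr (_ * _).
  case: (boolP [forall _ in D, _]) => [/forall_inP H | /forall_inPn[i Di not_lt]].
    by rewrite big1 // => i /H->.
  by rewrite (bigD1 i) //= (negbTE not_lt) mul0r.
move=> w; apply: (iffP andP) => [[/'forall_'forall_implyP H1 /forall_inP H2] | [H1 H2]].
  by split.
by split; [apply/'forall_'forall_implyP | apply/forall_inP].
Qed.

Lemma schurE sh m :
  schur sh m = \sum_(t <- fiber (cell sh) m) ((semistandard t)%:R : int).
Proof.
apply: gen_seriesE => t; apply: (iffP andP).
  case=> /'forall_'forall_implyP H1 /'forall_'forall_implyP H2.
  by split=> c c' e_c lt_c; [apply: H1 | apply: H2]; rewrite e_c eqxx.
case=> H1 H2; split; apply/'forall_'forall_implyP => c c' /andP[/eqP]; [apply: H1 | apply: H2].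
Qed.

(** * Expansion of Schur functions into fundamental quasi-symmetric functions *)

Section SchurExpansion.
Variables (sh : seq nat) (n : nat) (m : monom).
Hypothesis card_cell : #|cell sh| = n.

Definition relabel (T : {ffun cell sh -> 'I_n}) (w : {ffun 'I_n -> nat}) :
    {ffun cell sh -> nat} := [ffun c => w (T c)].

(** Since T is a bijection from cells to labels, composing words with T is a monomial-preserving
    bijection onto fillings of the shape. *)
Lemma fundamental_relabel T : T \in SYT sh n ->
  fundamental (Des T) m = \sum_(t <- fiber (cell sh) m) ((standardizes T t)%:R : int).
Proof.
move=> T_syt; have [inj_T surj_T] := (SYT_inj T_syt, SYT_surj T_syt).
have [g gK Kg] : bijective T by apply: inj_card_bij; rewrite // card_ord card_cell.
have e_fiber : perm_eq [seq relabel T w | w <- fiber 'I_n m] (fiber (cell sh) m).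
  have mon_relabel w : wmon (relabel T w) = wmon w.
    rewrite /wmon [RHS](reindex T) /=; last by apply: onW_bij; exists g.
    by apply: eq_bigr => c _; rewrite ffunE.
  apply: uniq_perm; rewrite ?fiber_uniq //.
    rewrite map_inj_uniq ?fiber_uniq // => w w' /ffunP e; apply/ffunP => i.
    by have [c <-] := surj_T i; have := e c; rewrite !ffunE.
  move=> t; rewrite mem_fiber; apply/mapP/idP => [[w] | t_m].
    by rewrite mem_fiber => w_m ->; rewrite mon_relabel.
  have e_t : t = relabel T [ffun i => t (g i)] by apply/ffunP => c; rewrite !ffunE gK.
  by exists [ffun i => t (g i)]; rewrite // mem_fiber -mon_relabel -e_t.
rewrite -(perm_big _ e_fiber) big_map.
rewrite /fundamental (@gen_seriesE _ _ _ (fun w => standardizes T (relabel T w))) // => w.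
apply: (iffP andP) => [[/'forall_'forall_implyP le_w /'forall_'forall_implyP lt_w] | [le_w lt_w]].
  split=> [i j | i].
    have [c <-] := surj_T i; have [c' <-] := surj_T j => /le_w.
    by rewrite !ffunE.
  rewrite inE => /existsP[c /existsP[c' /and3P[/eqP T_c /eqP T_c' lt_c]]].
  by have := lt_w c c'; rewrite !ffunE T_c T_c' eqxx lt_c; apply.
split; apply/'forall_'forall_implyP => c c'; rewrite !ffunE; first exact: le_w.
case/andP=> /eqP e_c lt_c.
have lt_n : (T c < n.-1)%N by have := ltn_ord (T c'); rewrite /= in e_c *; lia.
pose i := Ordinal lt_n.
have lo_i : T c = lo i by apply: val_inj.
have hi_i : T c' = hi i by apply: val_inj.
rewrite lo_i hi_i; apply: lt_w; rewrite inE; apply/existsP; exists c.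
by apply/existsP; exists c'; rewrite lo_i hi_i !eqxx.
Qed.

Lemma schur_fundamental : schur sh m = \sum_(T in SYT sh n) fundamental (Des T) m.
Proof.
rewrite schurE (eq_bigr _ fundamental_relabel) exchange_big /=.
apply: eq_bigr => t _; rewrite -(card_standardizes card_cell) -sum1_card natr_sum.
rewrite [LHS]big_mkcond [RHS]big_mkcond; apply: eq_bigr => T _.
by rewrite in_set; case: (T \in SYT sh n); case: (standardizes T t).
Qed.

End SchurExpansion.

(** * Assembly of the two identities *)

Lemma card_two_row n k : (k <= n)%N -> #|cell (two_row n k)| = n.
Proof.
move=> le_kn; rewrite card_tagged sumnE big_map big_enum /= !big_ord_recl big_ord0.
by rewrite !card_ord /= addn0 subnK.
Qed.

Lemma sum_NC_SYT_ord (R : comPzRingType) n (q : 'I_n.-1 -> R) :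
  \sum_(P in NC n) \prod_(i in Desing P) q i =
  \sum_(k < n./2.+1)
     (\sum_(T in SYT (two_row n k) n) \prod_(i in Des T) q i) *+ dcoef n k.
Proof.
(* The recurrences use one weight sequence for all word lengths, so [q] is extended to all naturals
   with default value 1. *)
pose q' x := if insub x is Some i then q i else 1.
have q'E D : \prod_(i in D) q i = \prod_(i in D) q' (val i).
  by apply: eq_bigr => i _; rewrite /q' valK.
under eq_bigr do rewrite q'E.
under [RHS]eq_bigr do under eq_bigr do rewrite q'E.
exact: sum_NC_SYT.
Qed.

Theorem theorem5p5 (n : nat) :
  (\sum_(P in NC n) qmon (Desing P) =
     \sum_(k < n./2.+1)
        (\sum_(T in SYT (two_row n k) n) qmon (Des T)) *+ dcoef n k)
  /\
  (\sum_(P in NC n) fundamental (Desing P) =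
     \sum_(k < n./2.+1) schur (two_row n k) *+ dcoef n k :> series).
Proof.
split; first exact: sum_NC_SYT_ord.
apply/funext => m; rewrite !fct_sumE.
under eq_bigr do rewrite fundamentalE.
rewrite exchange_big /=.
(* For each fixed w the first identity is specialized to the 0/1 weights q_i = [w_i < w_{i+1}]
   supplied by [fundamentalE]. *)
under eq_bigr => w _ do rewrite -mulr_sumr sum_NC_SYT_ord mulr_sumr.
rewrite exchange_big /=; apply: eq_bigr => k _.
have le_kn : (k <= n)%N by have := ltn_ord k; lia.
rewrite natmulfctE (schur_fundamental _ (card_two_row le_kn)).
rewrite [in RHS](eq_bigr _ (fun T _ => fundamentalE (Des T) m)) exchange_big /= -sumrMnl.
by apply: eq_bigr => w _; rewrite mulrnAr mulr_sumr.
Qed.
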